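(* Let $G:\mathbb{R}\to\mathbb{R}$ be a measurable function that is not a.e. symmetric (i.e. it is not the case that $G(z)=G(-z)$ for a.e. $z$), and suppose that $G(\cdot\times M)\in L^2(\gamma)$ for some $M>1$. Then $G(\cdot\times y)\in L^2(\gamma)$ for all $y\in(0,M]$, and the interval $(0,M)$ contains no accumulation point of the set $$E=\{y\in(0,M):\ G(\cdot\times y)\text{ has Hermite rank}\ \ge 2\},$$ that is, $E'\cap(0,M)=\emptyset$, where $E'$ is the set of all accumulation points of $E$.
   Context: $\gamma(dx)=\phi(x)\,dx$ with $\phi(x)=(2\pi)^{-1/2}e^{-x^2/2}$ is the standard Gaussian measure on $\mathbb{R}$, and $L^2(\gamma)=\{G:\int_{\mathbb{R}}G(z)^2\phi(z)\,dz<\infty\}$. $G(\cdot\times y)$ denotes the function $z\mapsto G(yz)$. ''a.e.'' is with respect to Lebesgue measure. The Hermite polynomials are $H_0(x)=1$ and $H_m(x)=(-1)^m e^{x^2/2}\frac{d^m}{dx^m}e^{-x^2/2}$ for $m\ge1$ (so $H_1(x)=x$, $H_2(x)=x^2-1$). The Hermite rank of $f\in L^2(\gamma)$ is $\inf\{m\ge 1:\int_{\mathbb{R}} f(x)H_m(x)\,\gamma(dx)\ne 0\}$ (with $\inf\emptyset=\infty$). A point $x$ is an accumulation point of a set $E$ if every neighborhood of $x$ contains infinitely many elements of $E$. *)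

(* Defs.v *)
From HB Require Import structures.
From mathcomp Require Import all_boot all_order all_algebra.
From mathcomp Require Import all_classical all_reals all_analysis.
Import Order.TTheory GRing.Theory Num.Theory.
Import numFieldNormedType.Exports.

Set Implicit Arguments.
Unset Strict Implicit.
Unset Printing Implicit Defensive.

Local Open Scope classical_set_scope.
Local Open Scope ring_scope.

Section Hermite.
Context {R : realType}.

(* [normal_prob m s] takes the mean and the standard deviation. *)
Definition gaussian : probability (measurableTypeR R) R :=
  normal_prob (0 : R) (1 : R).

(* Membership in [Lfun] includes (Borel) measurability. *)
Definition L2_gaussian (f : R -> R) : Prop := f \in Lfun gaussian 2%:E.

Definition hermite (m : nat) (x : R) : R :=
  (-1) ^+ m * expR (x ^+ 2 / 2) *
    derive1n m (fun t : R => expR (- t ^+ 2 / 2)) x.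

(* The rank lives in \bar R so that the infimum of the empty set is +oo. The
   integral is the genuine coefficient when f is in L^2 of [gaussian], the only
   case in which the rank is meant to be used. *)
Definition hermite_rank (f : R -> R) : \bar R :=
  ereal_inf [set (m%:R)%:E | m in
    [set m : nat | (1 <= m)%N /\
      (\int[gaussian]_x (f x * hermite m x)%:E)%E <> 0%E]].

End Hermite.

(* Unlike [limit_point], every neighbourhood must meet E in infinitely many
   points. *)
Definition accumulation_points (T : topologicalType) (E : set T) : set T :=
  [set x | forall U, nbhs x U -> infinite_set (U `&` E)].

(* Main.v *)
Require Import Defs.
From HB Require Import structures.
From mathcomp Require Import all_boot all_order all_algebra.
From mathcomp Require Import all_classical all_reals all_analysis.
From mathcomp Require Import measurable_realfun.
From mathcomp Require Import ring lra.
Import Order.TTheory GRing.Theory Num.Theory.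
Import numFieldNormedType.Exports.
Local Open Scope classical_set_scope.
Local Open Scope ring_scope.

(** Writing the first Hermite coefficient of [G (y * _)] as a Lebesgue integral
    and substituting [u = y * z] turns it, up to a positive constant, into
    [\int u * G u * expR (- u ^+ 2 / (2 * y ^+ 2))], which is a Laplace transform
    in the variable [u ^+ 2], evaluated at [1 / (2 * y ^+ 2)]
    ([zero_hermite_coefficient]).  Square integrability of [G (M * _)] makes this
    transform converge absolutely, and therefore be analytic, for all [0 < y < M]
    ([integrable_weighted]).  The rank is at least [2] exactly at the zeros of
    the transform, so an accumulation point of such [y] inside [(0, M)] makes it
    vanish identically; by uniqueness of Laplace transforms the even part of
    [u * G u] is then null, that is, [G] is almost everywhere symmetric, contrary
    to hypothesis.

    Both analytic continuation and uniqueness are obtained by real methods, for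
    [\int psi * expR (- r * t)] with [t] a nonnegative measurable function on any
    measure space ([laplace_zeros_tail]).  A Taylor expansion shows that at an
    accumulation point [r0] of zeros all the moments
    [\int psi * expR (- r0 * t) * t ^+ k] vanish ([moments_eq0]).  Expanding
    [expR (- h * t)] propagates this to [r0 + h], and by iteration to the whole
    progression [r0 + n * (r0 / 2)] ([laplace_arithmetic_zeros]).  Along it the
    transform gives the moments of [psi * expR (- r0 * t)] with respect to
    [expR (- (r0 / 2) * t)], so this density is orthogonal to every entire
    function of [expR (- (r0 / 2) * t)]; suitable double exponentials of this form
    tend boundedly to the indicator of [a < t] ([integral_tail_eq0]).  With
    [t = u ^+ 2], reflection and Lebesgue differentiation then recover the even
    part almost everywhere ([ae_odd_of_tails_eq0]). *)

Set Implicit Arguments.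
Unset Strict Implicit.
Unset Printing Implicit Defensive.

(** * Taylor remainders of the exponential *)

Section taylor.
Context {R : realType}.
Implicit Types x : R.

Lemma exprn_le_fact_expR x n : 0 <= x -> x ^+ n <= n`!%:R * expR x.
Proof.
move=> x0; rewrite mulrC -ler_pdivrMr ?ltr0n ?fact_gt0//.
case: n => [|n].
  by rewrite expr0 fact0 divr1 -[leLHS]addr0 (le_trans _ (expR_ge1Dx x))// lerD2l.
by rewrite (le_trans _ (expR_ge1Dxn n x0))// lerDr.
Qed.

Lemma series_exp_coeff_le x n : 0 <= x -> series (exp_coeff x) n <= expR x.
Proof.
move=> x0; apply: nondecreasing_cvgn_le; last exact: is_cvg_series_exp_coeff.
apply/nondecreasing_seqP => m; rewrite !seriesEnat/= big_nat_recr//= lerDl.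
exact: exp_coeff_ge0.
Qed.

Lemma norm_series_exp_coeff_le x n :
  `|series (exp_coeff x) n| <= expR `|x|.
Proof.
apply: le_trans (series_exp_coeff_le n (normr_ge0 x)).
rewrite -(normed_series_exp_coeff x); exact: ler_norm_sum.
Qed.

Lemma expR_taylor_bound x n :
  `|expR x - series (exp_coeff x) n| <= `|x| ^+ n * expR `|x|.
Proof.
have cvgS := is_cvg_series_exp_coeff x.
have : `|series (exp_coeff x) m - series (exp_coeff x) n| @[m --> \oo]
    --> `|expR x - series (exp_coeff x) n|.
  by apply: cvg_norm; apply: cvgB; [exact: cvgS | exact: cvg_cst].
move=> cvgD; rewrite -(cvg_lim (@Rhausdorff R) cvgD); apply: limr_le.
  by apply/cvg_ex; eexists; exact: cvgD.
near=> m.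
have nm : (n <= m)%N by near: m; exact: nbhs_infty_ge.
rewrite sub_series_geq//.
rewrite (le_trans (ler_norm_sum _ _ _))// -{1}[n]add0n big_addn.
apply: (@le_trans _ _ (\sum_(0 <= i < m - n) `|x| ^+ n * exp_coeff `|x| i)).
  rewrite ler_sum_nat// => i _; rewrite /exp_coeff/= normrM normfV normrX.
  rewrite exprD (normr_nat R) mulrAC [leLHS]mulrC ler_wpM2l ?exprn_ge0//.
  rewrite ler_wpM2l ?exprn_ge0// lef_pV2 ?posrE ?ltr0n ?fact_gt0// ler_nat.
  by rewrite leq_fact// leq_addr.
rewrite -mulr_sumr ler_wpM2l ?exprn_ge0//.
exact: (series_exp_coeff_le (m - n) (normr_ge0 x)).
Unshelve. all: by end_near. Qed.

End taylor.

(** * Functions orthogonal to all powers *)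

Section power_tests.
Context d (T : measurableType d) (R : realType).
Variable mu : {measure set T -> \bar R}.
Implicit Types (f g t w psi : T -> R).

Lemma le_integrable_EFin f g : measurable_fun [set: T] f ->
    (forall x, `|f x| <= `|g x|) ->
  mu.-integrable [set: T] (EFin \o g) -> mu.-integrable [set: T] (EFin \o f).
Proof.
move=> mf fg; apply: le_integrable => //; first exact/measurable_EFinP.
by move=> x _; rewrite /= !lee_fin.
Qed.

Lemma integral_series_exp_coeff w g n :
    (forall j, mu.-integrable [set: T] (fun x => (w x * g x ^+ j)%:E)) ->
  (\int[mu]_x (w x * series (exp_coeff (g x)) n)%:E =
   \sum_(0 <= j < n) (j`!%:R^-1)%:E * \int[mu]_x (w x * g x ^+ j)%:E)%E.
Proof.
move=> iwg.
under eq_integral => x _.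
  rewrite /series/= mulr_sumr -sumEFin.
  under eq_bigr => i _ do rewrite /exp_coeff/= mulrA mulrC EFinM.
  over.
rewrite integral_sum//=; last by move=> i; exact: integrableZl.
by apply: eq_bigr => i _; rewrite integralZl.
Qed.

(** Integrating the exponential series term by term: the partial sums are
    dominated by [expR `|g|], whose product with [w] is integrable. *)
Lemma integral_exp_eq0 w g :
    measurable_fun [set: T] w -> measurable_fun [set: T] g ->
    mu.-integrable [set: T] (fun x => (w x * expR `|g x|)%:E) ->
    (forall j, (\int[mu]_x (w x * g x ^+ j)%:E = 0)%E) ->
  (\int[mu]_x (w x * expR (g x))%:E = 0)%E.
Proof.
move=> mw mg iw wg0.
have mwS n : measurable_fun [set: T]
    (fun x => w x * series (exp_coeff (g x)) n).
  apply: measurable_funM => //; rewrite /series/=.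
  by apply: measurable_sum => i; apply: measurable_funM => //;
    exact: measurable_funX.
have iwg j : mu.-integrable [set: T] (fun x => (w x * g x ^+ j)%:E).
  apply: (@le_integrable_EFin _ (fun x => j`!%:R * (w x * expR `|g x|))).
  - by apply: measurable_funM => //; exact: measurable_funX.
  - move=> x; rewrite !normrM normrX (normr_nat R) (ger0_norm (expR_ge0 _)).
    by rewrite mulrCA ler_wpM2l// exprn_le_fact_expR.
  - exact: (integrableZl measurableT j`!%:R iw).
have S0 n : (\int[mu]_x (w x * series (exp_coeff (g x)) n)%:E = 0)%E.
  by rewrite integral_series_exp_coeff// big1// => j _; rewrite wg0 mule0.
have [|||||_ _] := @dominated_convergence _ _ _ mu [set: T] measurableT
    (fun n x => (w x * series (exp_coeff (g x)) n)%:E)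
    (fun x => (w x * expR (g x))%:E)
    (fun x => `|(w x * expR `|g x|)%:E|%E).
- by move=> n; exact/measurable_EFinP.
- apply/measurable_EFinP; apply: measurable_funM => //.
  exact: measurableT_comp.
- apply/aeW => x _; apply: cvg_EFin; first exact: nearW.
  apply: cvgM; [exact: cvg_cst | exact: is_cvg_series_exp_coeff].
- exact: integrable_abse.
- apply/aeW => x n _; rewrite lee_fin !normrM (ger0_norm (expR_ge0 _)).
  by rewrite ler_wpM2l// norm_series_exp_coeff_le.
under eq_fun do rewrite S0.
by move=> /cvg_lim <-//; rewrite lim_cst.
Qed.

(** Any spare exponential decay [b - a] absorbs the power [t ^+ k]. *)
Lemma integrable_moment w t (a b : R) k :
    measurable_fun [set: T] w -> measurable_fun [set: T] t ->
    (forall x, 0 <= t x) -> a < b ->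
    mu.-integrable [set: T] (fun x => (w x * expR (b * t x))%:E) ->
  mu.-integrable [set: T] (fun x => (w x * t x ^+ k * expR (a * t x))%:E).
Proof.
move=> mw mt t0 ab iw.
have ba0 : 0 < b - a by rewrite subr_gt0.
pose C : R := k`!%:R * (b - a) ^- k.
apply: (@le_integrable_EFin _ (fun x => C * (w x * expR (b * t x)))).
- apply: measurable_funM.
    by apply: measurable_funM => //; exact: measurable_funX.
  by apply: measurableT_comp => //; exact: measurable_funM.
- move=> x; rewrite /C !normrM !(ger0_norm (expR_ge0 _)) normrX.
  rewrite (ger0_norm (t0 x)) (normr_nat R) mulrCA -mulrA ler_wpM2l//.
  rewrite (@ger0_norm _ (_ ^- _)) ?invr_ge0 ?exprn_ge0 ?(ltW ba0)//.
  rewrite [b * _](_ : _ = (b - a) * t x + a * t x); last by ring.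
  rewrite expRD mulrA ler_wpM2r ?expR_ge0//.
  rewrite mulrAC ler_pdivlMr ?exprn_gt0//.
  by rewrite mulrC -exprMn exprn_le_fact_expR// mulr_ge0// ltW.
- exact: (integrableZl measurableT C iw).
Qed.

(** The function [r |-> \int w * expR (r * t)] is analytic near [0] with Taylor
    coefficients [\int w * t ^+ k / k`!].  If [k] is the first index whose
    coefficient [a] is not yet known to vanish, the expansion of order [k] at a
    zero [r] reads [0 = a * r ^+ k / k`! + O(r ^+ k.+1)], so [a] is bounded by a
    multiple of [`|r|], and [r] can be taken arbitrarily small. *)
Lemma moments_eq0 w t (b : R) :
    measurable_fun [set: T] w -> measurable_fun [set: T] t ->
    (forall x, 0 <= t x) -> 0 < b ->
    mu.-integrable [set: T] (fun x => (w x * expR (b * t x))%:E) ->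
    (forall e, 0 < e -> exists r, [/\ r != 0, `|r| < e &
      (\int[mu]_x (w x * expR (r * t x))%:E = 0)%E]) ->
  forall k, (\int[mu]_x (w x * t x ^+ k)%:E = 0)%E.
Proof.
move=> mw mt t0 b0 iw zeros.
have imom k (a : R) : a < b ->
    mu.-integrable [set: T] (fun x => (w x * t x ^+ k * expR (a * t x))%:E).
  by move=> ab; exact: integrable_moment iw.
have iwt k : mu.-integrable [set: T] (fun x => (w x * t x ^+ k)%:E).
  apply: eq_integrable (imom k 0 b0) => // x _.
  by rewrite mul0r expR0 mulr1.
elim/ltn_ind => k IH.
have b20 : 0 < b / 2 by rewrite divr_gt0.
have b2b : b / 2 < b by rewrite ltr_pdivrMr// ltr_pMr// ltr1n.
pose I := \int[mu]_x `|w x * t x ^+ k.+1 * expR (b / 2 * t x)|.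
have I0 : 0 <= I by apply: Rintegral_ge0 => x _.
pose a := \int[mu]_x (w x * t x ^+ k).
suff a0 : a = 0.
  rewrite -[LHS]fineK; first by rewrite -/(Rintegral _ _ _) -/a a0.
  exact: integrable_fin_num (iwt k).
suff bound r : r != 0 -> `|r| < b / 2 ->
    (\int[mu]_x (w x * expR (r * t x))%:E = 0)%E -> `|a| <= k`!%:R * I * `|r|.
  apply/eqP; rewrite -normr_le0; apply/ler_addgt0Pr => e e0; rewrite add0r.
  (* the first bound keeps the Taylor remainder integrable, the second makes
     the bound on `|a| smaller than e *)
  have [|r [r0 re wr]] := zeros (Num.min (b / 2) (e / (k`!%:R * I + 1))).
    by rewrite lt_min b20/= divr_gt0// ltr_wpDl// mulr_ge0.
  move: re; rewrite lt_min => /andP[rb re].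
  apply: le_trans (bound _ r0 rb wr) _.
  have C0 : 0 < k`!%:R * I + 1 by rewrite ltr_wpDl// mulr_ge0.
  move: re; rewrite ltr_pdivlMr// => /ltW; apply: le_trans.
  by rewrite mulrC ler_wpM2l// lerDl.
move=> r0 rb wr.
have irt j : mu.-integrable [set: T] (fun x => (w x * (r * t x) ^+ j)%:E).
  rewrite (_ : (fun _ => _) = (fun x => (r ^+ j)%:E * (w x * t x ^+ j)%:E)%E).
    exact: integrableZl.
  by apply/funext => x; rewrite -EFinM exprMn mulrCA.
have SE : (\int[mu]_x (w x * series (exp_coeff (r * t x)) k.+1)%:E
    = (k`!%:R^-1 * r ^+ k * a)%:E)%E.
  rewrite integral_series_exp_coeff//.
  have rtE j : (\int[mu]_x (w x * (r * t x) ^+ j)%:E =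
      (r ^+ j)%:E * \int[mu]_x (w x * t x ^+ j)%:E)%E.
    rewrite -integralZl//; apply: eq_integral => x _.
    by rewrite -EFinM exprMn mulrCA.
  rewrite big_nat_recr//= big1_seq ?add0e; last first.
    move=> j; rewrite mem_index_iota => /andP[_ jk].
    by rewrite rtE IH// !mule0.
  rewrite rtE -[X in (_ * (_ * X))%E]fineK; last exact: integrable_fin_num.
  by rewrite -!EFinM mulrA.
have rt_le x : `|r * t x| <= b / 2 * t x.
  by rewrite normrM (ger0_norm (t0 x)) ler_wpM2r// ltW.
have ib2 := imom 0%N _ b2b.
have iexp : mu.-integrable [set: T] (fun x => (w x * expR (r * t x))%:E).
  apply: le_integrable_EFin ib2.
    apply: measurable_funM => //.
    by apply: measurableT_comp => //; exact: measurable_funM.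
  move=> x; rewrite expr0 mulr1 !normrM !(ger0_norm (expR_ge0 _)) ler_wpM2l//.
  by rewrite ler_expR (le_trans (ler_norm _)).
have iS : mu.-integrable [set: T]
    (fun x => (w x * series (exp_coeff (r * t x)) k.+1)%:E).
  apply: le_integrable_EFin ib2.
    apply: measurable_funM => //; rewrite /series/=.
    apply: measurable_sum => i; apply: measurable_funM => //.
    by apply: measurable_funX; exact: measurable_funM.
  move=> x; rewrite expr0 mulr1 !normrM !(ger0_norm (expR_ge0 _)) ler_wpM2l//.
  by rewrite (le_trans (norm_series_exp_coeff_le _ _))// ler_expR.
have RE : \int[mu]_x (w x * expR (r * t x) -
    w x * series (exp_coeff (r * t x)) k.+1) = - (k`!%:R^-1 * r ^+ k * a).
  by rewrite RintegralB// /Rintegral wr SE/= sub0r.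
have : `|k`!%:R^-1 * r ^+ k * a| <= `|r| ^+ k.+1 * I.
  rewrite -normrN -RE (le_trans (le_normr_Rintegral _ _))//.
    exact: (@integrableB _ _ _ mu _ measurableT _ _ iexp iS).
  have iI := @integrable_norm _ _ _ mu [set: T] _ (imom k.+1 _ b2b).
  rewrite -RintegralZl//; apply: le_Rintegral => //.
  - apply: (@integrable_norm _ _ _ mu [set: T]
      (fun x => w x * expR (r * t x) - w x * series (exp_coeff (r * t x)) k.+1)).
    exact: (@integrableB _ _ _ mu _ measurableT _ _ iexp iS).
  - exact: (integrableZl measurableT _ iI).
  - move=> x _; rewrite -mulrBr !normrM !(ger0_norm (expR_ge0 _)) normrX.
    rewrite -mulrA mulrCA ler_wpM2l// mulrA -exprMn -normrM.
    rewrite (le_trans (expR_taylor_bound _ _))//.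
    by rewrite ler_wpM2l ?exprn_ge0// ler_expR.
rewrite !normrM normrX normfV (normr_nat R) exprSr -!mulrA.
rewrite mulrCA ler_pM2l ?exprn_gt0 ?normr_gt0// mulrC ler_pdivrMr ?ltr0n ?fact_gt0//.
by rewrite [k`!%:R * _]mulrC [I * _]mulrC.
Qed.

End power_tests.

(** * Zeros of a Laplace transform *)

Section laplace.
Context d (T : measurableType d) (R : realType).
Variable mu : {measure set T -> \bar R}.
Variables psi t : T -> R.
Hypotheses (mpsi : measurable_fun [set: T] psi) (mt : measurable_fun [set: T] t).
Hypothesis t0 : forall x, 0 <= t x.
Hypothesis ipsi : forall r, 0 < r ->
  mu.-integrable [set: T] (fun x => (psi x * expR (- r * t x))%:E).

(** Expanding [expR (- h * t)] under the integral: this is one step of analytic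
    continuation, a Taylor series at [r] with all coefficients zero being
    followed to the point [r + h] of its disc of convergence. *)
Lemma laplace_moments_translate (r h : R) : 0 < h -> h < r ->
    (forall k, (\int[mu]_x (psi x * expR (- r * t x) * t x ^+ k)%:E = 0)%E) ->
  forall k,
    (\int[mu]_x (psi x * expR (- (r + h) * t x) * t x ^+ k)%:E = 0)%E.
Proof.
move=> h0 hr mom k.
have mexp a : measurable_fun [set: T] (fun x => expR (a * t x)).
  by apply: measurableT_comp => //; exact: measurable_funM.
have := @integral_exp_eq0 _ _ _ mu (fun x => psi x * t x ^+ k * expR (- r * t x))
  (fun x => - h * t x).
have EE x : psi x * t x ^+ k * expR (- r * t x) * expR (- h * t x) =
    psi x * expR (- (r + h) * t x) * t x ^+ k.
  by rewrite opprD mulrDl expRD; ring.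
under eq_integral do rewrite EE; apply => //.
- by do 2! apply: measurable_funM => //; exact: measurable_funX.
- exact: measurable_funM.
- have rh : - r + h < - ((r - h) / 2) by lra.
  have rh0 : 0 < (r - h) / 2 by lra.
  apply: eq_integrable (integrable_moment k mpsi mt t0 rh (ipsi rh0)) => // x _.
  congr EFin; rewrite normrM normrN (gtr0_norm h0) (ger0_norm (t0 x)).
  by rewrite -[RHS]mulrA -expRD -mulrDl.
- move=> j; rewrite -[RHS](mule0 ((- h) ^+ j)%:E) -(mom (k + j)%N) -integralZl//.
    by apply: eq_integral => x _; rewrite -EFinM exprMn exprD; congr EFin; ring.
  have r2 : - r < - (r / 2) by lra.
  have r20 : 0 < r / 2 by lra.
  apply: eq_integrable (integrable_moment (k + j) mpsi mt t0 r2 (ipsi r20)) => // x _.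
  by rewrite mulrAC.
Qed.

(** The integrals converge for all [0 < r], so a step [r0 / 2] stays inside the
    disc of convergence at every point to the right of [r0]; the vanishing along
    this progression is all that inversion needs. *)
Lemma laplace_arithmetic_zeros (r0 : R) : 0 < r0 ->
    (forall e, 0 < e -> exists r, [/\ r != r0, `|r - r0| < e &
      (\int[mu]_x (psi x * expR (- r * t x))%:E = 0)%E]) ->
  forall n,
    (\int[mu]_x (psi x * expR (- (r0 + n%:R * (r0 / 2)) * t x))%:E = 0)%E.
Proof.
move=> r00 zeros n.
have mexp a : measurable_fun [set: T] (fun x => expR (a * t x)).
  by apply: measurableT_comp => //; exact: measurable_funM.
suff : forall k, (\int[mu]_x (psi x *
    expR (- (r0 + n%:R * (r0 / 2)) * t x) * t x ^+ k)%:E = 0)%E.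
  by move/(_ 0%N); under eq_integral do rewrite expr0 mulr1.
elim: n => [|n IH]; last first.
  move=> k.
  rewrite (_ : r0 + n.+1%:R * (r0 / 2) = r0 + n%:R * (r0 / 2) + r0 / 2); last first.
    by rewrite -natr1; ring.
  apply: laplace_moments_translate => //; first by lra.
  have : 0 <= n%:R * (r0 / 2) by rewrite mulr_ge0// divr_ge0// ltW.
  by lra.
rewrite mul0r addr0.
have r02 : 0 < r0 / 2 by rewrite divr_gt0.
apply: (@moments_eq0 _ _ _ mu _ t (r0 / 2)) => //.
- exact: measurable_funM.
- apply: eq_integrable (ipsi r02) => // x _.
  by rewrite -mulrA -expRD; congr (EFin (_ * expR _)); field.
- move=> e /zeros[r [rr0 re zr]]; exists (r0 - r).
  rewrite subr_eq0 eq_sym rr0 distrC re; split => //.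
  rewrite -[RHS]zr; apply: eq_integral => x _.
  by rewrite -mulrA -expRD; congr (EFin (_ * expR _)); ring.
Qed.

End laplace.

(** * Inversion on half-lines *)

Section double_exponential.
Context {R : realType}.

(** The inner factor [n] makes the exponent diverge even at [c = 0], where the
    summand [1] decides the limit; hence the limit is an indicator function with
    no exceptional value at the jump. *)
Lemma cvg_double_exponential (c : R) :
  expR (- expR (n%:R * (n%:R * c + 1))) @[n --> \oo] --> ((c < 0)%R%:R : R).
Proof.
have [c0|c0] := ltP c 0.
  suff cvg0 : expR (n%:R * (n%:R * c + 1)) @[n --> \oo] --> (0 : R).
    rewrite (_ : true%:R = expR (- 0)); last by rewrite oppr0 expR0.
    apply: continuous_cvg; first exact: continuous_expR.
    exact: cvgN.
  apply: (@squeeze_cvgr _ _ _ _ (cst 0) (fun n => expR (- n%:R))).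
  - near=> n; rewrite expR_ge0/= ler_expR.
    have nc : 1 <= - (n%:R * c + 1).
      rewrite opprD lerBrDr -mulrN -ler_pdivrMr ?oppr_gt0// ltW//.
      by near: n; exact: nbhs_infty_gtr.
    by rewrite lerNr -mulrN -[leLHS]mulr1 ler_wpM2l.
  - exact: cvg_cst.
  - exact: cvgn_expR.
apply: (@squeeze_cvgr _ _ _ _ (cst 0) (fun n => expR (- n%:R))).
- apply: nearW => n; rewrite expR_ge0/= ler_expR lerN2.
  apply: (le_trans _ (expR_ge1Dx _)); rewrite -[leLHS]mulr1.
  apply: (@le_trans _ _ (n%:R * (n%:R * c + 1))); last by rewrite lerDr.
  by rewrite ler_wpM2l// lerDr mulr_ge0.
- exact: cvg_cst.
- exact: cvgn_expR.
Unshelve. all: by end_near. Qed.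

End double_exponential.

Lemma integral_mulr_indic d (T : measurableType d) (R : realType)
    (mu : {measure set T -> \bar R}) (A : set T) (f : T -> R) :
  (\int[mu]_(x in A) (f x)%:E = \int[mu]_x (f x * \1_A x)%:E)%E.
Proof.
rewrite integral_mkcond; apply: eq_integral => x _; rewrite patchE indicE.
by case: ifP => _; rewrite ?mulr1 ?mulr0.
Qed.

Section laplace_tail.
Context d (T : measurableType d) (R : realType).
Variable mu : {measure set T -> \bar R}.

(** The double exponentials [expR (- expR (n * (n * h * (a - t) + 1)))] are
    bounded by [1], tend to the indicator of [a < t], and are power series in
    [expR (- h * t)], so their integrals against [w] vanish. *)
Lemma integral_tail_eq0 (w t : T -> R) (h : R) :
    mu.-integrable [set: T] (EFin \o w) ->
    measurable_fun [set: T] t -> (forall x, 0 <= t x) -> 0 < h ->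
    (forall n : nat, (\int[mu]_x (w x * expR (- (n%:R * h) * t x))%:E = 0)%E) ->
  forall a : R, (\int[mu]_(x in [set x | (a < t x)%R]) (w x)%:E = 0)%E.
Proof.
move=> iw mt t0 h0 w0 a.
have mw : measurable_fun [set: T] w.
  by apply/measurable_EFinP; exact: measurable_int iw.
pose C n : R := expR (n%:R * (n%:R * (h * a) + 1)).
pose g n x : R := - expR (n%:R * (n%:R * (h * (a - t x)) + 1)).
(* exhibits g n as a constant multiple of a power of expR (- h * t) *)
have gE n x : g n x = - C n * expR (- ((n * n)%N%:R * h) * t x).
  by rewrite /g /C mulNr -expRD natrM; congr (- expR _); ring.
have mg n : measurable_fun [set: T] (g n).
  apply: measurableT_comp => //; apply: measurableT_comp => //.
  apply: measurable_funM => //; apply: measurable_funD => //.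
  by apply: measurable_funM => //; apply: measurable_funM => //; exact: measurable_funB.
have gC n x : `|g n x| <= C n.
  rewrite gE normrM normrN !(ger0_norm (expR_ge0 _)) ler_piMr ?expR_ge0//.
  by rewrite expR_le1 mulNr oppr_le0 !mulr_ge0// ltW.
have weg0 n : (\int[mu]_x (w x * expR (g n x))%:E = 0)%E.
  apply: integral_exp_eq0 => //.
    apply: (@le_integrable_EFin _ _ _ mu _ (fun x => expR (C n) * w x)).
    - apply: measurable_funM => //; apply: measurableT_comp => //.
      exact: measurableT_comp.
    - move=> x; rewrite !normrM !(ger0_norm (expR_ge0 _)) mulrC ler_wpM2r//.
      by rewrite ler_expR.
    - exact: (integrableZl measurableT (expR (C n)) iw).
  move=> j; rewrite -[RHS](mule0 ((- C n) ^+ j)%:E) -(w0 (j * (n * n))%N).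
  rewrite -integralZl//.
    apply: eq_integral => x _; rewrite gE -EFinM exprMn -expRM_natl.
    by rewrite [in RHS]natrM; congr EFin; rewrite mulrCA; do 2 congr (_ * _);
      congr expR; ring.
  apply: le_integrable_EFin iw.
    apply: measurable_funM => //; apply: measurableT_comp => //.
    exact: measurable_funM.
  move=> x; rewrite normrM (ger0_norm (expR_ge0 _)) ler_piMr//.
  by rewrite expR_le1 mulNr oppr_le0 !mulr_ge0// ltW.
pose A := [set x | a < t x].
have mA : measurable A.
  rewrite -[A]setTI; apply: (@measurable_lte _ _ _ _ _ (cst a%:E) (EFin \o t)) => //.
  exact/measurable_EFinP.
have [|||||_ _] := @dominated_convergence _ _ _ mu [set: T] measurableT
    (fun n x => (w x * expR (g n x))%:E)
    (fun x => (w x * \1_A x)%:E) (fun x => `|(w x)%:E|%E).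
- by move=> n; apply/measurable_EFinP/measurable_funM => //; exact: measurableT_comp.
- by apply/measurable_EFinP/measurable_funM => //; exact: measurable_indic.
- apply/aeW => x _; apply: cvg_EFin; first exact: nearW.
  apply: cvgM; first exact: cvg_cst.
  have := @cvg_double_exponential R (h * (a - t x)).
  rewrite pmulr_rlt0// subr_lt0 indicE.
  suff -> : (x \in A) = (a < t x) by [].
  by apply/idP/idP; rewrite inE.
- exact: integrable_abse.
- apply/aeW => x n _; rewrite lee_fin normrM (ger0_norm (expR_ge0 _)).
  by rewrite ler_piMr// expR_le1 oppr_le0 expR_ge0.
under eq_fun do rewrite weg0.
move=> /cvg_lim; rewrite lim_cst// => /(_ (@ereal_hausdorff R)) wA0.
by rewrite -[LHS]/(\int[mu]_(x in A) (w x)%:E)%E integral_mulr_indic wA0.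
Qed.

End laplace_tail.

Section laplace_uniqueness.
Context d (T : measurableType d) (R : realType).
Variable mu : {measure set T -> \bar R}.

(** An accumulation point of zeros inside the domain of a Laplace transform
    forces the transformed density to be null, expressed through its integrals
    over the sets [a < t] because [t] is an arbitrary nonnegative function. *)
Lemma laplace_zeros_tail (psi t : T -> R) (r0 : R) :
    measurable_fun [set: T] psi -> measurable_fun [set: T] t ->
    (forall x, 0 <= t x) ->
    (forall r, 0 < r ->
      mu.-integrable [set: T] (fun x => (psi x * expR (- r * t x))%:E)) ->
    0 < r0 ->
    (forall e, 0 < e -> exists r, [/\ r != r0, `|r - r0| < e &
      (\int[mu]_x (psi x * expR (- r * t x))%:E = 0)%E]) ->
  forall a : R,
    (\int[mu]_(x in [set x | (a < t x)%R]) (psi x * expR (- r0 * t x))%:E = 0)%E.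
Proof.
move=> mpsi mt t0 ipsi r00 zeros.
apply: (@integral_tail_eq0 _ _ _ mu _ t (r0 / 2)) => //.
- exact: ipsi.
- by rewrite divr_gt0.
move=> n; rewrite -[RHS](laplace_arithmetic_zeros mpsi mt t0 ipsi r00 zeros n).
apply: eq_integral => x _; rewrite -mulrA -expRD.
by congr (EFin (_ * expR _)); ring.
Qed.

End laplace_uniqueness.

(** * Scaling of Lebesgue measure *)

Lemma gt0_muleBr {R : realType} (k : R) (x y : \bar R) : 0 < k ->
  (k%:E * (x - y) = k%:E * x - k%:E * y)%E.
Proof.
move=> k0; case: x => [x| |]; case: y => [y| |] //=;
  rewrite ?addNye ?addeNy ?addye ?addey ?gt0_muley ?gt0_muleNy ?lte_fin//.
by rewrite -EFinB -!EFinM -EFinB mulrBr.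
Qed.

Section lebesgue_change_of_variables.
Context {R : realType}.
Notation mu := (@lebesgue_measure R).

Lemma lebesgue_measure_scale (c : R) (A : set R) : c != 0 -> measurable A ->
  pushforward mu (fun x => c * x : measurableTypeR R) A = (`|c|^-1%:E * mu A)%E.
Proof.
move=> c0 mA.
have c0' : 0 < `|c| by rewrite normr_gt0.
have mc : measurable_fun [set: measurableTypeR R]
    (fun x : measurableTypeR R => c * x : measurableTypeR R).
  exact: measurable_funM.
pose cnng : {nonneg R} := NngNum (normr_ge0 c).
have muE X : measurable X ->
    mu X = mscale cnng (pushforward mu (fun x => c * x : measurableTypeR R)) X.
  apply: lebesgue_measure_unique => //= _ [[a b]] _ <-/=.
  rewrite /mscale/= /pushforward.
  have [cn|cp|/eqP] := ltgtP c 0; last by rewrite (negbTE c0).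
    rewrite (_ : _ @^-1` _ = `[b / c, a / c[%classic); last first.
      apply/seteqP; split => x /=; rewrite !in_itv/=.
        by rewrite ler_ndivrMr// ltr_ndivlMr// [x * c]mulrC andbC.
      by rewrite ler_ndivrMr// ltr_ndivlMr// [x * c]mulrC andbC.
    rewrite !lebesgue_measure_itv/= !lte_fin ltr_nM2r ?invr_lt0//.
    case: ifP => _; last by rewrite mule0.
    by rewrite -!EFinD -EFinM ltr0_norm//; congr EFin; field.
  rewrite (_ : _ @^-1` _ = `]a / c, b / c]%classic); last first.
    apply/seteqP; split => x /=; rewrite !in_itv/=.
      by rewrite ltr_pdivrMr// ler_pdivlMr// [x * c]mulrC.
    by rewrite ltr_pdivrMr// ler_pdivlMr// [x * c]mulrC.
  rewrite !lebesgue_measure_itv/= !lte_fin ltr_pM2r ?invr_gt0//.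
  case: ifP => _; last by rewrite mule0.
  by rewrite -!EFinD -EFinM gtr0_norm//; congr EFin; field.
rewrite (muE mc A mA) /mscale/= muleA -EFinM mulVf ?mul1e//.
by rewrite gt_eqF.
Qed.

Lemma ge0_integral_scale (c : R) (f : R -> \bar R) : c != 0 ->
    measurable_fun [set: R] f -> (forall x, (0 <= f x)%E) ->
  (\int[mu]_x f (c * x)%R = `|c|^-1%:E * \int[mu]_x f x)%E.
Proof.
move=> c0 mf f0.
have mc : measurable_fun [set: measurableTypeR R]
    (fun x : measurableTypeR R => c * x : measurableTypeR R).
  exact: measurable_funM.
have c0' : 0 <= `|c|^-1 by rewrite invr_ge0.
rewrite -(@ge0_integral_mscale _ _ _ mu setT measurableT (NngNum c0') f mf)//.
transitivity (\int[pushforward mu (fun x => (c * x)%R : measurableTypeR R)]_x f x)%E.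
  by rewrite ge0_integral_pushforward//=.
apply: eq_measure_integral => //= A mA _.
exact: lebesgue_measure_scale.
Qed.

Lemma integral_scale (c : R) (f : R -> \bar R) : c != 0 ->
    measurable_fun [set: R] f ->
  (\int[mu]_x f (c * x)%R = `|c|^-1%:E * \int[mu]_x f x)%E.
Proof.
move=> c0 mf; rewrite [in LHS]integralE [in RHS]integralE.
have posE : (fun x => f (c * x)%R)^\+%E = (fun x => f^\+%E (c * x)).
  by apply/funext => x; rewrite !funeposE.
have negE : (fun x => f (c * x)%R)^\-%E = (fun x => f^\-%E (c * x)).
  by apply/funext => x; rewrite !funenegE.
rewrite posE negE.
rewrite (ge0_integral_scale c0 (measurable_funepos mf)); last first.
  by move=> x; exact: funepos_ge0.
rewrite (ge0_integral_scale c0 (measurable_funeneg mf)); last first.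
  by move=> x; exact: funeneg_ge0.
by rewrite [RHS]gt0_muleBr ?invr_gt0 ?normr_gt0.
Qed.

Lemma integral_reflect (f : R -> \bar R) : measurable_fun [set: R] f ->
  (\int[mu]_x f (- x)%R = \int[mu]_x f x)%E.
Proof.
move=> mf; have N10 : -1 != 0 :> R by rewrite oppr_eq0 oner_neq0.
under eq_integral do rewrite -mulN1r.
by rewrite integral_scale// normrN normr1 invr1 mul1e.
Qed.

Lemma integrable_reflect (f : R -> \bar R) : mu.-integrable [set: R] f ->
  mu.-integrable [set: R] (fun x => f (- x)).
Proof.
move=> /integrableP[mf foo]; apply/integrableP; split.
  by apply: measurableT_comp => //; exact: measurable_funN.
rewrite (@integral_reflect (fun x => `|f x|%E))//.
exact: measurableT_comp.
Qed.

End lebesgue_change_of_variables.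

(** * Integration against the Gaussian measure *)

Section gaussian_density.
Context {R : realType}.
Notation mu := (@lebesgue_measure R).

(** The density of [gaussian] agrees almost everywhere with its Radon-Nikodym
    derivative, for which the change of variables is known. *)
Lemma ge0_integral_gaussian (f : R -> \bar R) : measurable_fun [set: R] f ->
    (forall x, (0 <= f x)%E) ->
  (\int[gaussian]_x f x = \int[mu]_x (f x * (normal_pdf 0 1 x)%:E))%E.
Proof.
move=> mf f0.
have dom : gaussian `<< mu := @normal_prob_dominates R 0 1.
pose h := Radon_Nikodym_SigmaFinite.f gaussian mu.
have mpdf : measurable_fun [set: R] (EFin \o @normal_pdf R 0 1).
  by apply/measurable_EFinP; exact: measurable_normal_pdf.
have ih : mu.-integrable [set: R] h.
  exact: Radon_Nikodym_SigmaFinite.f_integrable.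
rewrite -(Radon_Nikodym_SigmaFinite.change_of_variables dom)//.
apply: ae_eq_integral => //.
- by apply: emeasurable_funM => //; exact: measurable_int ih.
- exact: emeasurable_funM.
- apply: ae_eqe_mul2l; apply: integral_ae_eq => // E _ mE.
  by rewrite -Radon_Nikodym_SigmaFinite.f_integral.
Qed.

Lemma integral_gaussian (f : R -> R) : measurable_fun [set: R] f ->
  (\int[gaussian]_x (f x)%:E = \int[mu]_x (f x * normal_pdf 0 1 x)%:E)%E.
Proof.
move=> mf; rewrite [LHS]integralE [RHS]integralE.
have mf' : measurable_fun [set: R] (EFin \o f) by exact/measurable_EFinP.
have pE x : (0 <= (normal_pdf 0 1 x)%:E :> \bar R)%E.
  by rewrite lee_fin normal_pdf_ge0.
congr (_ - _)%E.
- rewrite (ge0_integral_gaussian (measurable_funepos mf')); last first.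
    by move=> x; exact: funepos_ge0.
  apply: eq_integral => x _; rewrite !funeposE.
  by rewrite EFinM maxe_pMl// mul0e.
- rewrite (ge0_integral_gaussian (measurable_funeneg mf')); last first.
    by move=> x; exact: funeneg_ge0.
  apply: eq_integral => x _; rewrite !funenegE.
  by rewrite EFinM -mulNe maxe_pMl// mul0e.
Qed.

(** The constant [normal_peak 1] stays under the integral: for signed [f],
    pulling it out is legitimate only once the integrand is integrable. *)
Lemma integral_gaussian_scale (f : R -> R) (c : R) : 0 < c ->
    measurable_fun [set: R] f ->
  (\int[gaussian]_x (f (c * x))%:E =
   c^-1%:E * \int[mu]_x
     (normal_peak 1 * (f x * expR (- (2 * c ^+ 2)^-1 * x ^+ 2)))%:E)%E.
Proof.
move=> c0 mf.
pose k x : R := normal_peak 1 * (f x * expR (- (2 * c ^+ 2)^-1 * x ^+ 2)).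
have mk : measurable_fun [set: R] k.
  apply: measurable_funM => //; apply: measurable_funM => //.
  apply: measurableT_comp => //.
  by apply: measurable_funM => //; exact: measurable_funX.
rewrite integral_gaussian; last first.
  by apply: measurableT_comp => //; exact: measurable_funM.
have -> : c^-1 = `|c|^-1 by rewrite gtr0_norm.
rewrite -(@integral_scale R c (EFin \o k)) ?gt_eqF//; last exact/measurable_EFinP.
apply: eq_integral => x _.
rewrite normal_pdfE ?oner_neq0// /normal_fun /k/=; congr EFin.
rewrite mulrCA; congr (_ * (_ * expR _)).
by rewrite subr0 expr1n; field; rewrite gt_eqF.
Qed.

End gaussian_density.

(** * Functions with vanishing integrals on the sets u ^+ 2 > a *)

Section tail_uniqueness.
Context {R : realType}.
Notation mu := (@lebesgue_measure R).

(** By the Lebesgue differentiation theorem, [f] is almost everywhere the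
    derivative of its cumulative integral, which is constant. *)
Lemma ae_eq0_of_cumulative (f : R -> R) :
    mu.-integrable [set: R] (EFin \o f) ->
    (forall x, (\int[mu]_(u in `]-oo, x]) (f u)%:E = 0)%E) ->
  {ae mu, forall x, f x = 0}.
Proof.
move=> intf f0.
have /FTC1Ny : forall y, mu.-integrable `]-oo, y] (EFin \o f).
  by move=> y; exact: integrableS intf.
move=> /(_ (open_integrable_locally openT intf)).
apply: filterS; first exact: (ae_filter_ringOfSetsType mu).
move=> x [_ <-].
rewrite (_ : (fun _ => _) = cst 0) ?derive1_cst//.
by apply/funext => y; rewrite /Rintegral f0.
Qed.

(** The symmetrization [f u = q u + q (- u)] has zero cumulative integral.  By
    reflection, its integral over [A] is that of [q * sym A], where [sym A] adds
    the indicators of [A] and of its reflection.  For [x <= 0] and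
    [A = `]-oo, x[], [sym A] is the indicator of [x ^+ 2 < u ^+ 2]; for
    [0 < x] and [A = `]-oo, x]], it is [2] minus that indicator. *)
Lemma ae_odd_of_tails_eq0 (q : R -> R) :
    mu.-integrable [set: R] (EFin \o q) ->
    (forall a : R, (\int[mu]_(u in [set u | (a < u ^+ 2)%R]) (q u)%:E = 0)%E) ->
  {ae mu, forall u, q u + q (- u) = 0}.
Proof.
move=> iq tail0.
have mq : measurable_fun [set: R] q.
  by apply/measurable_EFinP; exact: measurable_int iq.
have iqM (A : set R) : measurable A ->
    mu.-integrable [set: R] (fun u => (q u * \1_A u)%:E).
  move=> mA; apply: le_integrable_EFin iq.
    by apply: measurable_funM => //; exact: measurable_indic.
  by move=> u; rewrite normrM ler_piMr// indicE; case: (_ \in _); rewrite ?normr1 ?normr0.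
pose sym (A : set R) u : R := \1_A u + \1_A (- u).
have symE (A : set R) : measurable A ->
    (\int[mu]_(u in A) (q u + q (- u))%:E = \int[mu]_u (q u * sym A u)%:E)%E.
  move=> mA; rewrite integral_mulr_indic.
  have mAN : measurable (-%R @^-1` A).
    rewrite -[_ @^-1` _]setTI; have : measurable_fun [set: R] (-%R : R -> R).
      exact: measurable_funN.
    exact.
  have NE u : \1_(-%R @^-1` A) u = \1_A (- u) :> R by [].
  have iN : mu.-integrable [set: R] (fun u => (q (- u) * \1_A u)%:E).
    apply: eq_integrable (integrable_reflect (iqM _ mAN)) => // u _.
    by rewrite NE opprK.
  under eq_integral do rewrite mulrDl.
  rewrite integralD_EFin//; last exact: iqM.
  transitivity (\int[mu]_u (q u * \1_A u)%:E +
      \int[mu]_u (q u * \1_(-%R @^-1` A) u)%:E)%E.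
    congr (_ + _)%E.
    rewrite -[RHS]integral_reflect; last exact: measurable_int (iqM _ mAN).
    apply: eq_integral => u _.
    by rewrite NE opprK.
  rewrite -integralD_EFin//; [|exact: iqM|exact: iqM].
  by apply: eq_integral => u _; rewrite /= -EFinD -mulrDr NE.
apply: ae_eq0_of_cumulative.
  exact: (integrableD measurableT iq (integrable_reflect iq)).
move=> x.
have memsqr u : (u \in [set v : R | x ^+ 2 < v ^+ 2]) = (x ^+ 2 < u ^+ 2).
  by apply/idP/idP; rewrite inE.
have [x0|x0] := leP x 0.
  (* with a closed end point, sym would take the value 2 at u = 0 when x = 0 *)
  rewrite -integral_itv_bndo_bndc; last first.
    apply/measurable_EFinP/measurable_funTS; apply: measurable_funD => //.
    by apply: measurableT_comp => //; exact: measurable_funN.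
  rewrite symE// -[RHS](tail0 (x ^+ 2)) [RHS]integral_mulr_indic.
  apply: eq_integral => u _; congr (EFin (_ * _)).
  rewrite /sym !indicE memsqr !mem_setE !in_itv/= expr2 expr2.
  case: (ltP u x); case: (ltP (- u) x); case: (ltP (x * x) (u * u)) => h1 h2 h3;
    rewrite ?addr0 ?add0r//; exfalso; nra.
rewrite symE//.
pose A := [set u : R | x ^+ 2 < u ^+ 2].
have mA : measurable A.
  have msqr : measurable_fun [set: R] (fun u : R => u ^+ 2) by exact: measurable_funX.
  have := msqr measurableT `]x ^+ 2, +oo[%classic (measurable_itv _).
  rewrite setTI; congr measurable; apply/seteqP.
  by split => u /=; rewrite in_itv/= andbT.
have tail_neg1 : (\int[mu]_u (q u)%:E = 0)%E.
  rewrite -(tail0 (-1)); congr integral; apply/esym/seteqP; split => // u _ /=.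
  by rewrite (lt_le_trans _ (sqr_ge0 _))// ltrN10.
transitivity (\int[mu]_u ((2%:E * (q u)%:E) - (q u * \1_A u)%:E))%E.
  apply: eq_integral => u _; rewrite -EFinM -EFinB; congr EFin.
  rewrite [2 * _]mulrC -mulrBr; congr (_ * _).
  rewrite /sym !indicE memsqr !mem_setE !in_itv/= expr2 expr2.
  case: (leP u x); case: (leP (- u) x); case: (ltP (x * x) (u * u)) => h1 h2 h3;
    rewrite ?addr0 ?add0r ?subr0//;
    first [by rewrite /=; lra | exfalso; nra].
rewrite [LHS](integralB measurableT (integrableZl measurableT 2 iq) (iqM A mA)).
by rewrite integralZl// tail_neg1 -[X in (_ - X)%E]integral_mulr_indic tail0 mule0 sube0.
Qed.

End tail_uniqueness.

(** * Hermite rank and square integrability of scaled functions *)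

Section hermite_first.
Context {R : realType}.
Notation mu := (@lebesgue_measure R).

Lemma hermite1 (x : R) : hermite 1 x = x.
Proof.
have dg : is_derive x 1 (fun t : R => expR (- t ^+ 2 / 2))
    (- x * expR (- x ^+ 2 / 2)).
  apply: is_derive_eq; rewrite /= /GRing.scale/=; lra.
rewrite /hermite derive1n1 derive1E derive_val expr1.
rewrite mulN1r mulNr mulNr mulrN opprK mulrCA -expRD.
by rewrite mulNr addrN expR0 mulr1.
Qed.

Lemma hermite_rank_ge2 (f : R -> R) : (2%:E <= hermite_rank f)%E ->
  (\int[gaussian]_x (f x * x)%:E = 0)%E.
Proof.
move=> rk; apply: contrapT => nz.
have : (hermite_rank f <= 1%:E)%E.
  apply: ereal_inf_lbound; exists 1%N => //; split => //.
  by under eq_integral do rewrite hermite1.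
by move=> /(le_trans rk); rewrite lee_fin lern1.
Qed.

Lemma L2_gaussianP (f : R -> R) : measurable_fun [set: R] f ->
  L2_gaussian f <-> (\int[gaussian]_x (f x ^+ 2)%:E < +oo)%E.
Proof.
move=> mf; split.
  move=> /Lfun2_integrable_sqr /integrableP[_]; apply: le_lt_trans.
  by apply: ge0_le_integral => //= *; rewrite ?lee_fin ?sqr_ge0 ?ler_norm//;
    apply/measurable_EFinP; do ?apply: measurableT_comp => //; exact: measurable_funX.
move=> fin; rewrite /L2_gaussian inE; apply/andP; split; rewrite inE//=.
rewrite /finite_norm unlock /=.
apply: poweR_lty; apply: le_lt_trans fin.
rewrite le_eqVlt; apply/orP; left; apply/eqP; apply: eq_integral => x _.
by rewrite /= powR_mulrn// real_normK// num_real.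
Qed.

(** With all scales written against Lebesgue measure, only the weight depends on
    [c], and it increases with [c]. *)
Lemma L2_gaussian_scaleP (G : R -> R) (c : R) : 0 < c ->
    measurable_fun [set: R] G ->
  L2_gaussian (fun z => G (c * z)) <->
  mu.-integrable [set: R]
    (fun x => (G x ^+ 2 * expR (- (2 * c ^+ 2)^-1 * x ^+ 2))%:E).
Proof.
move=> c0 mG.
have mGc : measurable_fun [set: R] (fun z => G (c * z)).
  by apply: measurableT_comp => //; exact: measurable_funM.
have mGe : measurable_fun [set: R]
    (fun x => (G x ^+ 2 * expR (- (2 * c ^+ 2)^-1 * x ^+ 2))).
  apply: measurable_funM; first exact: measurable_funX.
  by apply: measurableT_comp => //; apply: measurable_funM => //; exact: measurable_funX.
have Ge0 x : (0 <= (G x ^+ 2 * expR (- (2 * c ^+ 2)^-1 * x ^+ 2))%:E)%E.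
  by rewrite lee_fin mulr_ge0 ?sqr_ge0 ?expR_ge0.
have p0 : 0 < normal_peak 1 :> R by rewrite normal_peak_gt0// oner_neq0.
rewrite L2_gaussianP//.
rewrite (@integral_gaussian_scale _ (fun x => G x ^+ 2))//; last exact: measurable_funX.
under eq_integral do rewrite EFinM.
rewrite ge0_integralZl//; [|exact/measurable_EFinP|by rewrite lee_fin ltW].
rewrite muleA -EFinM.
have k0 : 0 < c^-1 * normal_peak 1 by rewrite mulr_gt0// invr_gt0.
have absE : (\int[mu]_x (G x ^+ 2 * expR (- (2 * c ^+ 2)^-1 * x ^+ 2))%:E =
  \int[mu]_x `|(G x ^+ 2 * expR (- (2 * c ^+ 2)^-1 * x ^+ 2))%:E|)%E.
  by apply: eq_integral => x _; rewrite gee0_abs.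
split.
  move=> fin; apply/integrableP; split; first exact/measurable_EFinP.
  rewrite -absE ltNge leye_eq; apply/negP => /eqP E.
  by move: fin; rewrite E gt0_muley ?lte_fin// ltxx.
move=> /integrableP[_]; rewrite -absE => fin.
by rewrite lte_mul_pinfty// lee_fin ltW.
Qed.

End hermite_first.

(** * The first Hermite coefficient as a Laplace transform *)

Section main.
Context {R : realType}.
Notation mu := (@lebesgue_measure R).

Lemma L2_gaussian_shrink (G : R -> R) (M y : R) : measurable_fun [set: R] G ->
    0 < y <= M -> L2_gaussian (fun z => G (M * z)) ->
  L2_gaussian (fun z => G (y * z)).
Proof.
move=> mG /andP[y0 yM]; have M0 := lt_le_trans y0 yM.
rewrite !L2_gaussian_scaleP//; apply: le_integrable_EFin.
  apply: measurable_funM; first exact: measurable_funX.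
  by apply: measurableT_comp => //; apply: measurable_funM => //; exact: measurable_funX.
move=> x; rewrite !normrM ler_wpM2l// !ger0_norm ?expR_ge0// ler_expR.
rewrite ler_wpM2r ?sqr_ge0// lerN2 lef_pV2 ?posrE ?mulr_gt0 ?exprn_gt0//.
by rewrite ler_pM2l// lerXn2r ?nnegrE// ltW.
Qed.

(** The part of the first Hermite coefficient of [G (y * _)] common to all [y];
    the Gaussian factor is the one at the extreme scale [M], so that the
    remaining factor decays for every [y < M]. *)
Definition weighted (G : R -> R) (M : R) (u : R) : R :=
  u * G u * expR (- (2 * M ^+ 2)^-1 * u ^+ 2).

(** The exponent left once [weighted] has taken its Gaussian factor: the first
    Hermite coefficient at scale [y] is, up to a positive constant, the Laplace
    transform of [weighted G M] in the variable [u ^+ 2] at [rate M y]. *)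
Definition rate (M y : R) : R := (2 * y ^+ 2)^-1 - (2 * M ^+ 2)^-1.

Lemma rate_gt0 (M y : R) : 0 < y < M -> 0 < rate M y.
Proof.
move=> /andP[y0 yM]; have M0 := lt_trans y0 yM.
rewrite /rate subr_gt0 ltf_pV2 ?posrE ?mulr_gt0 ?exprn_gt0//.
by rewrite ltr_pM2l// ltrXn2r ?nnegrE ?ltW.
Qed.

Lemma measurable_weighted G M : measurable_fun [set: R] G ->
  measurable_fun [set: R] (weighted G M).
Proof.
move=> mG; apply: measurable_funM; first exact: measurable_funM.
by apply: measurableT_comp => //; apply: measurable_funM => //; exact: measurable_funX.
Qed.

(** Comparison with [(G u ^+ 2 + 1) * expR (- u ^+ 2 / (2 * M ^+ 2))], which is
    integrable, the factor [u] being absorbed by [expR (- r * u ^+ 2)]. *)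
Lemma integrable_weighted (G : R -> R) (M r : R) : 0 < M ->
    measurable_fun [set: R] G -> L2_gaussian (fun z => G (M * z)) -> 0 < r ->
  mu.-integrable [set: R] (fun u => (weighted G M u * expR (- r * u ^+ 2))%:E).
Proof.
move=> M0 mG GM r0.
pose e (u : R) := expR (- (2 * M ^+ 2)^-1 * u ^+ 2).
have iG : mu.-integrable [set: R] (fun u => (G u ^+ 2 * e u)%:E).
  by apply/L2_gaussian_scaleP.
have ie : mu.-integrable [set: R] (fun u => (e u)%:E).
  have : L2_gaussian (fun z : R => cst (1 : R) (M * z)) by exact: Lfun_cst.
  move=> /(L2_gaussian_scaleP M0 (measurable_cst _)).
  apply: eq_integrable => // u _.
  by rewrite /= expr1n mul1r.
apply: (@le_integrable_EFin _ _ _ mu _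
    (fun u => (1 + r^-1) * (G u ^+ 2 * e u + e u))).
- apply: measurable_funM; first exact: measurable_weighted.
  by apply: measurableT_comp => //; apply: measurable_funM => //; exact: measurable_funX.
- move=> u; have e0 : 0 <= e u by exact: expR_ge0.
  have ri0 : 0 < r^-1 by rewrite invr_gt0.
  rewrite [leRHS]ger0_norm; last first.
    apply: mulr_ge0; first by rewrite addr_ge0// ltW.
    by rewrite addr_ge0// mulr_ge0// sqr_ge0.
  rewrite /weighted -/(e u) !normrM (ger0_norm e0) (ger0_norm (expR_ge0 _)).
  have uexp : `|u| * expR (- r * u ^+ 2) <= 1 + r^-1.
    rewrite mulNr expRN ler_pdivrMr ?expR_gt0//.
    apply: (@le_trans _ _ ((1 + r^-1) * (1 + r * u ^+ 2))); last first.
      by rewrite ler_wpM2l ?expR_ge1Dx// addr_ge0// ltW.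
    rewrite (_ : _ * _ = 1 + r^-1 + r * u ^+ 2 + u ^+ 2); last first.
      by field; rewrite gt_eqF.
    have : 0 <= r * u ^+ 2 by rewrite mulr_ge0 ?sqr_ge0// ltW.
    have : `|u| <= 1 + u ^+ 2.
      rewrite -[u ^+ 2]real_normK ?num_real//; have := normr_ge0 u; nra.
    lra.
  have Gsq : `|G u| * e u <= G u ^+ 2 * e u + e u.
    rewrite -[X in _ <= _ + X]mul1r -mulrDl ler_wpM2r//.
    rewrite -[G u ^+ 2]real_normK ?num_real//; have := normr_ge0 (G u); nra.
  rewrite [leLHS](_ : _ = (`|u| * expR (- r * u ^+ 2)) * (`|G u| * e u)); last by ring.
  by rewrite ler_pM ?mulr_ge0 ?expR_ge0.
- exact: (integrableZl measurableT (1 + r^-1) (integrableD measurableT iG ie)).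
Qed.

Lemma zero_hermite_coefficient (G : R -> R) (M y : R) : measurable_fun [set: R] G ->
    0 < y < M -> L2_gaussian (fun z => G (M * z)) ->
    (2%:E <= hermite_rank (fun z : R => G (y * z)%R))%E ->
  (\int[mu]_u (weighted G M u * expR (- rate M y * u ^+ 2))%:E = 0)%E.
Proof.
move=> mG /andP[y0 yM] GM /hermite_rank_ge2 H.
have M0 := lt_trans y0 yM.
have r0 : 0 < rate M y by apply: rate_gt0; rewrite y0.
have iw := integrable_weighted M0 mG GM r0.
have p0 : 0 < normal_peak 1 :> R by rewrite normal_peak_gt0// oner_neq0.
transitivity ((y ^+ 2 / normal_peak 1)%:E *
    \int[gaussian]_x (G (y * x)%R * x)%:E)%E; last first.
  by rewrite H mule0.
transitivity ((y ^+ 2 / normal_peak 1)%:E *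
    \int[gaussian]_x ((fun u => G u * (u / y)) (y * x)%R)%:E)%E; last first.
  congr (_ * _)%E; apply: eq_integral => x _; congr (EFin (_ * _)).
  by rewrite mulrAC divff ?mul1r// gt_eqF.
rewrite (@integral_gaussian_scale R (fun u => G u * (u / y)))//; last first.
  by apply: measurable_funM => //; exact: measurable_funM.
under [in RHS]eq_integral => u _.
  rewrite (_ : _ * _ = normal_peak 1 / y *
      (weighted G M u * expR (- rate M y * u ^+ 2))); last first.
    rewrite (_ : - (2 * y ^+ 2)^-1 * u ^+ 2 =
        - (2 * M ^+ 2)^-1 * u ^+ 2 + - rate M y * u ^+ 2).
      by rewrite expRD /weighted; ring.
    by rewrite /rate; ring.
  rewrite EFinM; over.
rewrite integralZl// !muleA -!EFinM.
rewrite (_ : _ * _ = 1) ?mul1e//.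
by field; rewrite !gt_eqF.
Qed.

Lemma rate_inj (M y z : R) : 0 < y -> 0 < z -> rate M y = rate M z -> y = z.
Proof.
have two_neq0 : 2 != 0 :> R by rewrite pnatr_eq0.
move=> y0 z0 /addIr /invr_inj /(mulfI two_neq0) /eqP.
by rewrite eqrXn2 ?ltW// => /eqP.
Qed.

Lemma continuous_rate (M y : R) : 0 < y -> {for y, continuous (rate M)}.
Proof.
move=> y0; apply: cvgB; last exact: cvg_cst.
apply: cvgV; first by rewrite mulf_neq0// ?expf_neq0// gt_eqF.
by apply: cvgM; [exact: cvg_cst | exact: exprn_continuous].
Qed.

(** As [rate M] is continuous and injective on positive scales, the zeros of the
    first Hermite coefficient near [y0] become zeros of a Laplace transform accumulating at
    [rate M y0]. The conclusion of the inversion is that the even function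
    [u * (G u - G (- u))], up to a Gaussian factor, is null. *)
Lemma accumulating_zeros_symmetric (G : R -> R) (M y0 : R) :
    measurable_fun [set: R] G -> L2_gaussian (fun z => G (M * z)) ->
    0 < y0 < M ->
    accumulation_points [set y : R | 0 < y < M /\
      (2%:E <= hermite_rank (fun z : R => (G (y * z))%R))%E] y0 ->
  {ae mu, forall z, G z = G (- z)}.
Proof.
move=> mG GM y0M acc; set E := [set y : R | _] in acc.
have /andP[y00 _] := y0M.
have M0 : 0 < M by case/andP: y0M; exact: lt_trans.
have r0 := rate_gt0 y0M.
have zeros e : 0 < e -> exists r, [/\ r != rate M y0, `|r - rate M y0| < e &
    (\int[mu]_u (weighted G M u * expR (- r * u ^+ 2))%:E = 0)%E].
  move=> e0.
  have /acc infE : nbhs y0 [set y | `|rate M y - rate M y0| < e].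
    have /cvgrPdist_lt /(_ e e0) := @continuous_rate M y0 y00.
    by apply: filterS => y /=; rewrite distrC.
  have [y [[/= yU [yM yrk]] yy0]] :
      exists y, ([set y | `|rate M y - rate M y0| < e] `&` E) y /\ y != y0.
    apply: contrapT => none; apply: infE.
    apply: (@sub_finite_set _ _ [set y0]); last exact: finite_set1.
    move=> y yUE /=; apply/eqP; apply: contra_notT none => yy0.
    by exists y.
  exists (rate M y); split => //; last exact: zero_hermite_coefficient.
  apply: contra_neq yy0; apply: rate_inj => //; by case/andP: yM.
have mw := @measurable_weighted G M mG.
have msqr : measurable_fun [set: R] (fun u : R => u ^+ 2) by exact: measurable_funX.
have tail0 := @laplace_zeros_tail _ (measurableTypeR R) R mu (weighted G M)
  (fun u => u ^+ 2) (rate M y0) mw msqr (fun u => sqr_ge0 u)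
  (fun r => @integrable_weighted G M r M0 mG GM) r0 zeros.
have := ae_odd_of_tails_eq0 (integrable_weighted M0 mG GM r0) tail0.
apply: filterS; first exact: (ae_filter_ringOfSetsType mu).
move=> z; have [->|z0] := eqVneq z 0; first by rewrite oppr0.
rewrite /weighted sqrrN.
set a := expR _; set b := expR _.
have -> : z * G z * a * b + - z * G (- z) * a * b = z * a * b * (G z - G (- z)).
  by ring.
move/eqP; rewrite !mulf_eq0 (negbTE z0) !expR_eq0/= subr_eq0.
by move/eqP.
Qed.

End main.

Unset Implicit Arguments.

Theorem theorem2p2 (R : realType) (G : R -> R) (M : R)
    (mG : measurable_fun [set: R] G)
    (nsymG : ~ {ae (@lebesgue_measure R), forall z : R, G z = G (- z)})
    (M1 : 1 < M)
    (GM : L2_gaussian (fun z : R => G (M * z))) :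
  (forall y : R, 0 < y <= M -> L2_gaussian (fun z : R => G (y * z))) /\
  accumulation_points
    [set y : R | 0 < y < M /\ (2%:E <= hermite_rank (fun z : R => (G (y * z))%R))%E]
    `&` [set y : R | 0 < y < M] = set0.
Proof.
split=> [y yM|]; first exact: L2_gaussian_shrink yM GM.
rewrite -subset0 => y0 [acc y0M]; apply: nsymG.
exact: accumulating_zeros_symmetric GM y0M acc.
Qed.
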